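(* Let $a<b$ be real, $W=[a,b]^3\subset\mathbb{R}^3$, and $\vec{\alpha}=(\alpha_1,\alpha_2,\alpha_3)$ with $0<\alpha_n\le 1$ for $n=1,2,3$. Let $\omega\neq 0$ be the frequency of oscillations, let $g_1,g_2,g_3$ be constants with $g_2,g_3\neq 0$, and put $\kappa:=\omega\sqrt{g_2^{-1}g_3^{-1}}$, where the square root is chosen so that $\operatorname{Im}\kappa\ge 0$. Let $\rho:W\to\mathbb{C}$ and $\vec{j}:W\to\mathbb{C}^3$ be the given complex amplitudes of the charge and current densities, and let $\vec{E},\vec{B}:W\to\mathbb{C}^3$ be the complex amplitudes of the electric and magnetic fields, where the components of $\vec{j},\vec{E},\vec{B}$ have real and imaginary parts in $AC^1[W]$. Define the purely vectorial biquaternionic functions $$\vec{\varphi}:=-i\omega g_2^{-1}g_3^{-1}\vec{E}+\kappa\vec{B},\qquad \vec{\psi}:=i\omega g_2^{-1}g_3^{-1}\vec{E}+\kappa\vec{B}.$$ Then the fractional quaternionic equations $$\left({}^C\mathcal{D}_W^{\vec{\alpha}}-\kappa\right)\vec{\varphi}=g_2^{-1}\left(\mathrm{Div}_W^{\vec{\alpha}}\,\vec{j}+\kappa\,\vec{j}\right),\qquad (1)$$ $$\left({}^C\mathcal{D}_W^{\vec{\alpha}}+\kappa\right)\vec{\psi}=g_2^{-1}\left(-\mathrm{Div}_W^{\vec{\alpha}}\,\vec{j}+\kappa\,\vec{j}\right)\qquad (2)$$ are equivalent to the fractional monochromatic Maxwell system $$\mathrm{Div}_W^{\vec{\alpha}}\vec{E}=g_1\rho,\qquad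 \mathrm{Curl}_W^{\vec{\alpha}}\vec{E}=i\omega\vec{B},\qquad \mathrm{Div}_W^{\vec{\alpha}}\vec{B}=0,\qquad \mathrm{Curl}_W^{\vec{\alpha}}\vec{B}=-i\omega g_2^{-1}g_3^{-1}\vec{E}+g_2^{-1}\vec{j}.\qquad (3)$$ That is, $\vec{\varphi}$ and $\vec{\psi}$ are solutions of (1) and (2), respectively, if and only if $\vec{E}$ and $\vec{B}$ are solutions of (3).
   Context: Complex quaternions (biquaternions) $\mathbb{H}(\mathbb{C})$: elements $q=q_0+\vec{q}=\sum_{n=0}^3 q_ne_n$ with $q_n\in\mathbb{C}$, $e_0=1$, $e_me_n+e_ne_m=-2\delta_{mn}$ for $m,n\in\{1,2,3\}$, $e_1e_2=e_3$, $e_2e_3=e_1$, $e_3e_1=e_2$; the complex imaginary unit $i$ commutes with all $e_n$. The scalar part is $q_0$ and the vector part is $\vec{q}=q_1e_1+q_2e_2+q_3e_3$; purely vectorial elements ($q_0=0$) are identified with vectors $(q_1,q_2,q_3)$, and scalars with elements having $\vec q=0$ (so $\mathrm{Div}_W^{\vec\alpha}\,\vec{j}+\kappa\vec{j}$ is the biquaternion with scalar part $\mathrm{Div}_W^{\vec\alpha}\,\vec{j}$ and vector part $\kappa\vec{j}$). Function class: $AC^1[a,b]$ is the class of continuously differentiable functions which are absolutely continuous on $[a,b]$. $AC^1[W]$ is the class of real functions on $W=[a,b]^3$ whose restrictions in each coordinate variable $x_n$ (the other two coordinates being fixed) belong to $AC^1[a,b]$. Left Caputo derivative: for $0<\beta<1$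 and $f\in AC^1[a,b]$, $$({}_a^CD_x^{\beta}f)(x)=\frac{1}{\Gamma(1-\beta)}\int_a^x\frac{f'(\tau)}{(x-\tau)^{\beta}}\,d\tau,$$ and for $\beta=1$, ${}_a^CD_x^{1}f=f'$; it is extended complex-linearly to complex-valued functions. For $n=1,2,3$ let $D_n$ denote the left Caputo derivative of order $\frac{1+\alpha_n}{2}$ with base point $a$ in the variable $x_n$. Fractional vector operators, for $\vec{U}=(U_1,U_2,U_3)$: $$\mathrm{Div}_W^{\vec{\alpha}}\vec{U}:=D_1U_1+D_2U_2+D_3U_3,$$ $$\mathrm{Curl}_W^{\vec{\alpha}}\vec{U}:=e_1(D_2U_3-D_3U_2)+e_2(D_3U_1-D_1U_3)+e_3(D_1U_2-D_2U_1).$$ Fractional Dirac operator: ${}^C\mathcal{D}_W^{\vec{\alpha}}:=e_1D_1+e_2D_2+e_3D_3$, acting on $\mathbb{H}(\mathbb{C})$-valued functions $U=\sum_{m=0}^3U_me_m$ by left multiplication: ${}^C\mathcal{D}_W^{\vec{\alpha}}U=\sum_{n=1}^3\sum_{m=0}^3 (D_nU_m)\,e_ne_m$.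
   Formalization: The formal theorem additionally assumes charge conservation, Div j = iω g₁ g₃⁻¹ ρ on W; without it the equivalence is false (j = E = B = 0, ρ = 1, g₁ = g₂ = g₃ = ω = 1 satisfies (1), (2) but not Div E = g₁ρ). *)

(* Defs.v *)
From HB Require Import structures.
From mathcomp Require Import all_boot all_order all_algebra.
From mathcomp Require Import complex.
From mathcomp Require Import all_classical all_reals all_analysis.
From mathcomp Require Import ring.

Set Implicit Arguments.
Unset Strict Implicit.
Unset Printing Implicit Defensive.

Import Order.TTheory GRing.Theory Num.Theory.
Import numFieldNormedType.Exports.

Local Open Scope classical_set_scope.
Local Open Scope ring_scope.

Section OneVariable.
Context {R : realType}.
Implicit Types (a b x beta : R) (f : R -> R).

Definition diff_quotient f x (t : R) : R := (f t - f x) / (t - x).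

(* Neighbourhoods of x in [a, b], punctured at x: limits along this filter are
   one-sided at a and at b. *)
Definition within_itv a b x : set_system R := within `[a, b] x^'.

Definition deriv_on a b f x : R := lim (diff_quotient f x @ within_itv a b x).

Definition cont_diff_on a b f : Prop :=
  (forall x, x \in `[a, b] -> cvg (diff_quotient f x @ within_itv a b x)) /\
  {within `[a, b], continuous (deriv_on a b f)}.

Definition abs_cont_on a b f : Prop :=
  forall e : R, 0 < e -> exists2 d : R, 0 < d &
    forall (n : nat) (u v : 'I_n -> R),
      (forall i, a <= u i /\ u i <= v i /\ v i <= b) ->
      (forall i k, i != k -> v i <= u k \/ v k <= u i) ->
      \sum_(i < n) (v i - u i) < d ->
      \sum_(i < n) `|f (v i) - f (u i)| < e.

Definition AC1 a b f : Prop := cont_diff_on a b f /\ abs_cont_on a b f.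

Definition Gamma (z : R) : R :=
  \int[lebesgue_measure]_(t in `]0, +oo[) (t `^ (z - 1) * expR (- t)).

Definition caputo a b beta f x : R :=
  if beta == 1 then deriv_on a b f x
  else (Gamma (1 - beta))^-1 *
       \int[lebesgue_measure]_(t in `[a, x]) (deriv_on a b f t / (x - t) `^ beta).

Definition caputoC a b beta (f : R -> R[i]) x : R[i] :=
  Complex (caputo a b beta (fun t => complex.Re (f t)) x)
          (caputo a b beta (fun t => complex.Im (f t)) x).

End OneVariable.

Notation "''x1'" := (@Ordinal 3 0 isT) (at level 0).
Notation "''x2'" := (@Ordinal 3 1 isT) (at level 0).
Notation "''x3'" := (@Ordinal 3 2 isT) (at level 0).

Section Cube.
Context {R : realType}.
Implicit Types (a b : R) (alpha : 'I_3 -> R) (x : 'rV[R]_3) (n : 'I_3).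

Definition cube a b : set 'rV[R]_3 := [set x | forall n, x 0 n \in `[a, b]].

Definition set_coord x n (t : R) : 'rV[R]_3 :=
  \row_m (if m == n then t else x 0 m).

(* Functions on the cube are represented by total functions on R^3; none of the
   definitions below looks at values outside the cube. *)
Definition AC1_cube a b (u : 'rV[R]_3 -> R) : Prop :=
  forall x, cube a b x -> forall n, AC1 a b (fun t => u (set_coord x n t)).

Definition AC1_field a b (U : 'rV[R]_3 -> 'rV[R[i]]_3) : Prop :=
  forall m : 'I_3, AC1_cube a b (fun x => complex.Re (U x 0 m)) /\
                   AC1_cube a b (fun x => complex.Im (U x 0 m)).

Definition pcaputo a b alpha n (u : 'rV[R]_3 -> R[i]) x : R[i] :=
  caputoC a b ((1 + alpha n) / 2) (fun t => u (set_coord x n t)) (x 0 n).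

Definition fdiv a b alpha (U : 'rV[R]_3 -> 'rV[R[i]]_3) x : R[i] :=
  \sum_(n < 3) pcaputo a b alpha n (fun y => U y 0 n) x.

Definition fcurl a b alpha (U : 'rV[R]_3 -> 'rV[R[i]]_3) x : 'rV[R[i]]_3 :=
  let D n m := pcaputo a b alpha n (fun y => U y 0 m) x in
  \row_k [:: D 'x2 'x3 - D 'x3 'x2;
             D 'x3 'x1 - D 'x1 'x3;
             D 'x1 'x2 - D 'x2 'x1]`_k.

End Cube.

Section Biquaternions.
Variable C : comNzRingType.

(* q = q_0 + q_1 e_1 + q_2 e_2 + q_3 e_3 is the row of its coefficients. *)
Local Notation quat := 'rV[C]_4.

Definition quat_e (m : 'I_4) : quat := delta_mx 0 m.

Definition quat_mul (p q : quat) : quat :=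
  let P k := p 0 (inord k) in let Q k := q 0 (inord k) in
  \row_(m < 4)
    [:: P 0%N * Q 0%N - P 1%N * Q 1%N - P 2%N * Q 2%N - P 3%N * Q 3%N;
        P 0%N * Q 1%N + P 1%N * Q 0%N + P 2%N * Q 3%N - P 3%N * Q 2%N;
        P 0%N * Q 2%N + P 2%N * Q 0%N + P 3%N * Q 1%N - P 1%N * Q 3%N;
        P 0%N * Q 3%N + P 3%N * Q 0%N + P 1%N * Q 2%N - P 2%N * Q 1%N]`_m.

Definition quat_of (s : C) (v : 'rV[C]_3) : quat :=
  \row_(m < 4) (if unlift ord0 m is Some n then v 0 n else s).

Definition quat_vec (n : 'I_3) : quat := quat_e (lift ord0 n).

Let inordE k : (k < 4)%N -> (inord k : 'I_4) = k :> nat.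
Proof. exact: inordK. Qed.

Let quatE (u v : quat) :
  (forall k, (k < 4)%N -> u 0 (inord k) = v 0 (inord k)) -> u = v.
Proof. by move=> h; apply/rowP => i; rewrite -(inord_val i) h. Qed.

Lemma quat_mul1q (q : quat) : quat_mul (quat_e ord0) q = q.
Proof.
by apply: quatE; case=> [|[|[|[|//]]]] _;
  rewrite !mxE !inordE //= !eqE /= !inordE //=; ring.
Qed.

Lemma quat_mulA (p q r : quat) :
  quat_mul p (quat_mul q r) = quat_mul (quat_mul p q) r.
Proof.
by apply: quatE; case=> [|[|[|[|//]]]] _; rewrite !mxE !inordE //=; ring.
Qed.

Lemma quat_anticomm (m n : 'I_3) :
  quat_mul (quat_vec m) (quat_vec n) + quat_mul (quat_vec n) (quat_vec m) =
  (- (m == n)%:R *+ 2) *: quat_e ord0.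
Proof.
by apply: quatE; case=> [|[|[|[|//]]]] _; case: m => [[|[|[|//]]] ?];
  case: n => [[|[|[|//]]] ?];
  rewrite !mxE !inordE //= !eqE /= !inordE //= /bump /=; ring.
Qed.

Lemma quat_e12 : quat_mul (quat_vec 'x1) (quat_vec 'x2) = quat_vec 'x3.
Proof.
by apply: quatE; case=> [|[|[|[|//]]]] _;
  rewrite !mxE !inordE //= !eqE /= !inordE //= /bump /=; ring.
Qed.

Lemma quat_e23 : quat_mul (quat_vec 'x2) (quat_vec 'x3) = quat_vec 'x1.
Proof.
by apply: quatE; case=> [|[|[|[|//]]]] _;
  rewrite !mxE !inordE //= !eqE /= !inordE //= /bump /=; ring.
Qed.

Lemma quat_e31 : quat_mul (quat_vec 'x3) (quat_vec 'x1) = quat_vec 'x2.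
Proof.
by apply: quatE; case=> [|[|[|[|//]]]] _;
  rewrite !mxE !inordE //= !eqE /= !inordE //= /bump /=; ring.
Qed.

End Biquaternions.

Definition fdirac {R : realType} (a b : R) (alpha : 'I_3 -> R)
    (U : 'rV[R]_3 -> 'rV[R[i]]_4) (x : 'rV[R]_3) : 'rV[R[i]]_4 :=
  \sum_(n < 3) \sum_(m < 4)
    pcaputo a b alpha n (fun y => U y 0 m) x *:
      quat_mul (quat_vec R[i] n) (quat_e R[i] m).

(* Conservation of charge for the amplitudes (time factor exp(- i omega t)) of
   densities whose time-dependent Maxwell equations are
     div E = g1 rho,   g2 curl B = j + g3^-1 dE/dt.
   It is part of what makes rho and j a charge and a current density: it cannot
   be deduced from the Maxwell system here, since div (curl B) need not vanish
   for B that is only separately continuously differentiable. *)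
Definition charge_conservation {R : realType} (a b : R) (alpha : 'I_3 -> R)
    (omega g1 g3 : R[i]) (rho : 'rV[R]_3 -> R[i])
    (j : 'rV[R]_3 -> 'rV[R[i]]_3) : Prop :=
  forall x, cube a b x ->
    fdiv a b alpha j x = 'i%C * omega * g1 * g3^-1 * rho x.

(* Main.v *)
(* A vector field V satisfies D V = - Div V + Curl V, the scalar and vector
   parts of the fractional Dirac operator.  Since the Caputo derivative is linear
   on continuously differentiable functions, (1) and (2) split into scalar and
   vector equations in Div E, Div B, Curl E, Curl B, and half the sum and half
   the difference of (1) and (2) are (3) up to the non-zero factors kappa and
   c = i omega / (g2 g3), because c (i omega) = - kappa^2; charge conservation
   turns Div j into rho.  Linearity of the Caputo integral needs its integrand to
   be integrable: it is a continuous function times (x - t)^(-beta), and the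
   latter is integrable for beta < 1 by monotone convergence on [a, x - 1/n]. *)
Require Import Defs.
From mathcomp Require Import all_boot all_order all_algebra.
From mathcomp Require Import complex.
From mathcomp Require Import all_classical all_reals all_analysis measurable_realfun.
From mathcomp Require Import ring.

Import Order.TTheory GRing.Theory Num.Theory.
Import numFieldNormedType.Exports.

Local Open Scope classical_set_scope.
Local Open Scope ring_scope.

(** * One-sided derivatives on a segment: uniqueness of limits and linearity *)

Lemma within_itv_proper (R : realType) (a b x : R) :
  a < b -> x \in `[a, b] -> ProperFilter (within_itv a b x).
Proof.
move=> ab; rewrite in_itv /= => /andP[ax xb].
apply: Build_ProperFilter_ex => P.
rewrite /within_itv /within /= => /nbhs_ballP[e /= e0 Pe].
have [xltb|bx] := ltP x b.
(* A point of [[a, b]] other than x within distance e: move right by at most e / 2, truncated at b.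
   If x = b, move left instead, truncated at a; [a < b] keeps the point distinct from x. *)
- pose y := Num.min (x + e / 2) b.
  have xy : x < y by rewrite lt_min ltrDl divr_gt0.
  exists y; apply: Pe => /=.
  + rewrite /ball /= distrC gtr0_norm ?subr_gt0// ltrBlDl.
    by rewrite gt_min ltrD2l; apply/orP; left; rewrite gtr_pMr// invf_lt1// ltr1n.
  + by rewrite gt_eqF.
  + by rewrite /= in_itv /= ge_min lexx orbT andbT (le_trans ax)// ltW.
- pose y := Num.max (x - e / 2) a.
  have yx : y < x by rewrite gt_max ltrBlDr ltrDl divr_gt0//= (lt_le_trans ab).
  exists y; apply: Pe => /=.
  + rewrite /ball /= gtr0_norm ?subr_gt0// ltrBlDr -ltrBlDl.
    by rewrite lt_max ltrD2l; apply/orP; left; rewrite ltrN2 gtr_pMr// invf_lt1// ltr1n.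
  + by rewrite lt_eqF.
  + by rewrite /= in_itv /= le_max lexx orbT /= (le_trans _ xb)// ltW.
Qed.

Lemma diff_quotient_lincomb (R : realType) (k l x : R) (f g : R -> R) :
  diff_quotient (fun t => k * f t + l * g t) x =
  (fun t => k * diff_quotient f x t + l * diff_quotient g x t).
Proof. by apply/funext => t; rewrite /diff_quotient; ring. Qed.

Section DerivOn.
Context {R : realType} (a b : R).
Hypothesis ab : a < b.
Implicit Types (f g : R -> R) (k l x : R).

Lemma cvg_diff_quotient_lincomb k l f g x :
  x \in `[a, b] -> cont_diff_on a b f -> cont_diff_on a b g ->
  diff_quotient (fun t => k * f t + l * g t) x @ within_itv a b x -->
  k * deriv_on a b f x + l * deriv_on a b g x.
Proof.
move=> xab [df _] [dg _]; rewrite diff_quotient_lincomb.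
have PF := within_itv_proper R a b x ab xab.
by apply: cvgD; apply: cvgM; [exact: cvg_cst|exact: df|exact: cvg_cst|exact: dg].
Qed.

Lemma deriv_on_lincomb k l f g x :
  x \in `[a, b] -> cont_diff_on a b f -> cont_diff_on a b g ->
  deriv_on a b (fun t => k * f t + l * g t) x =
  k * deriv_on a b f x + l * deriv_on a b g x.
Proof.
move=> xab df dg; have PF := within_itv_proper R a b x ab xab.
by apply: cvg_lim => //; exact: cvg_diff_quotient_lincomb.
Qed.

Lemma cont_diff_on_lincomb k l f g :
  cont_diff_on a b f -> cont_diff_on a b g ->
  cont_diff_on a b (fun t => k * f t + l * g t).
Proof.
move=> df dg; split.
  move=> x xab; apply/cvg_ex; exists (k * deriv_on a b f x + l * deriv_on a b g x).
  exact: cvg_diff_quotient_lincomb.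
have [_ cf] := df; have [_ cg] := dg.
(* The derivative of the combination is known only at points of [[a, b]], which suffices for
   continuity in the subspace topology. *)
apply: (@subspace_eq_continuous _ _ _
  (fun x => k * deriv_on a b f x + l * deriv_on a b g x)).
  by move=> x; rewrite inE => xab; rewrite /from_subspace deriv_on_lincomb.
move=> x; apply: cvgD; apply: cvgM;
  [exact: cvg_cst|exact: cf|exact: cvg_cst|exact: cg].
Qed.

Lemma deriv_on0 x : x \in `[a, b] -> deriv_on a b (fun=> 0) x = 0.
Proof.
move=> xab; have PF := within_itv_proper R a b x ab xab.
rewrite /deriv_on (_ : diff_quotient _ _ = fun=> 0).
  exact: (cvg_lim _ (cvg_cst _)).
by apply/funext => t; rewrite /diff_quotient subr0 mul0r.
Qed.

End DerivOn.

(** * Integrability of the weakly singular kernel *)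

Section Kernel.
Context {R : realType}.
Notation mu := (@lebesgue_measure R).

Lemma is_derive_powR_subl (x t p : R) : t < x ->
  is_derive t 1 (fun t => (x - t) `^ p) (- p * (x - t) `^ (p - 1)).
Proof.
move=> tx; have xt0 : 0 < x - t by rewrite subr_gt0.
have dsub : is_derive t (1 : R) (fun t => x - t) (-1).
  by rewrite -[X in is_derive _ _ _ X]add0r; exact: is_deriveB.
have := @is_derive1_comp _ (fun u : R => u `^ p) (fun t => x - t) t _ _
  (is_derive1_powR p xt0) dsub.
by move/is_derive_eq; apply; ring.
Qed.

Lemma is_derive_primitive (x t beta : R) : t < x -> beta < 1 ->
  is_derive t 1 (fun t => - (1 - beta)^-1 * (x - t) `^ (1 - beta))
    ((x - t) `^ (- beta)).
Proof.
move=> tx b1.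
have dF := @is_deriveZ _ _ _ _ (- (1 - beta)^-1) t _ _
  (is_derive_powR_subl x t (1 - beta) tx).
apply: is_derive_eq dF _.
rewrite /GRing.scale /= (_ : 1 - beta - 1 = - beta); last by ring.
have : 1 - beta != 0 by rewrite subr_eq0 gt_eqF.
by move=> ?; field.
Qed.

Lemma integral_kernel_le (a y x beta : R) : y < x -> beta < 1 -> 
  (\int[mu]_(t in `[a, y]) ((x - t) `^ (- beta))%:E <=
   ((1 - beta)^-1 * (x - a) `^ (1 - beta))%:E)%E.
Proof.
move=> yx b1.
have K0 : 0 <= (1 - beta)^-1 * (x - a) `^ (1 - beta).
  by rewrite mulr_ge0 ?powR_ge0// invr_ge0 subr_ge0 ltW.
have [ay|ya|] := ltgtP a y.
- have dF t : t \in `[a, y] -> is_derive t 1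
      (fun t => - (1 - beta)^-1 * (x - t) `^ (1 - beta)) ((x - t) `^ (- beta)).
    rewrite in_itv => /andP[_ ty].
    by apply: is_derive_primitive => //; exact: le_lt_trans yx.
  rewrite (@continuous_FTC2 _ _ (fun t => - (1 - beta)^-1 * (x - t) `^ (1 - beta)))//.
  + rewrite -EFinB lee_fin mulNr mulNr opprK addrC lerBlDr lerDl.
    by rewrite mulr_ge0 ?powR_ge0// invr_ge0 subr_ge0 ltW.
  + apply: derivable_within_continuous => t; rewrite in_itv /= => /andP[_ ty].
    by have [] := is_derive_powR_subl x t (- beta) (le_lt_trans ty yx).
  + have : {within `[a, y], continuous
        (fun t => - (1 - beta)^-1 * (x - t) `^ (1 - beta))}.
      by apply: derivable_within_continuous => t /dF[].
    move/(continuous_within_itvP _ ay) => [_ ca cy].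
    by split => // t /subset_itv_oo_cc /dF[].
  + by move=> t /subset_itv_oo_cc /dF ?; rewrite derive1E derive_val.
- by rewrite set_itv_ge ?integral_set0 ?lee_fin// bnd_simp -ltNge.
- by move=> ay; rewrite -ay set_itv1 integral_set1 lee_fin.
Qed.

Lemma measurable_kernel (x beta : R) (D : set R) :
  measurable_fun D (fun t => (x - t) `^ (- beta)).
Proof.
apply: (measurableT_comp (f := fun u : R => u `^ (- beta))
  (g := fun t : R => x - t)) => //.
exact: measurable_funB.
Qed.

Lemma integrable_kernel (a x beta : R) : beta < 1 ->
  mu.-integrable `[a, x] (EFin \o (fun t => (x - t) `^ (- beta))).
Proof.
move=> b1; apply/integrableP; split.
  by apply/measurable_EFinP; exact: measurable_kernel.
under eq_integral do rewrite /= ger0_norm ?powR_ge0//.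
(* The endpoint x has measure zero; without it the interval is exhausted by the segments [F n], on
   which the uniform bound applies. *)
rewrite -integral_itv_bndo_bndc; last first.
  by apply/measurable_EFinP; exact: measurable_kernel.
pose F (n : nat) : set R := `[a, x - n.+1%:R^-1]%classic.
have -> : `[a, x[%classic = \bigcup_n F n.
  apply/seteqP; split => t /=; rewrite in_itv /=.
  - move=> /andP[at_]; rewrite -subr_gt0 => tx.
    have [n /= ntx] := filter_ex (near_infty_natSinv_lt (PosNum tx)).
    by exists n => //=; rewrite /F /= in_itv /= at_ /= lerBrDr -lerBrDl ltW.
  - move=> [n _]; rewrite /F /= in_itv /= => /andP[-> h] /=.
    by apply: le_lt_trans h _; rewrite ltrBlDr ltrDl invr_gt0 ltr0n.
apply: (@le_lt_trans _ _ ((1 - beta)^-1 * (x - a) `^ (1 - beta))%:E); last exact: ltry.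
have cvF : (\int[mu]_(t in F n) ((x - t) `^ (- beta))%:E)%E @[n --> \oo] -->
    (\int[mu]_(t in \bigcup_n F n) ((x - t) `^ (- beta))%:E)%E.
  apply: ge0_nondecreasing_set_cvg_integral.
  - apply/nondecreasing_seqP => n; rewrite subsetEset /F; apply: subset_itvl.
    by rewrite bnd_simp lerD2l lerN2 lef_pV2 ?posrE ?ltr0n// ler_nat.
  - by move=> n; exact: measurable_itv.
  - by move=> n; apply/measurable_EFinP; exact: measurable_kernel.
  - by move=> n t _; rewrite lee_fin powR_ge0.
rewrite -(cvg_lim _ cvF)//; apply: lime_le; first by apply/cvg_ex; eexists; exact: cvF.
apply: nearW => n; apply: integral_kernel_le => //.
by rewrite ltrBlDr ltrDl invr_gt0 ltr0n.
Qed.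

(** On a compact segment h is bounded and measurable, and such a factor preserves integrability of
    the kernel. *)
Lemma integrable_continuous_kernel (a x beta : R) (h : R -> R) :
  beta < 1 -> {within `[a, x], continuous h} ->
  mu.-integrable `[a, x] (EFin \o (fun t => h t / (x - t) `^ beta)).
Proof.
move=> b1 ch.
rewrite (_ : EFin \o _ =
    ((EFin \o h) \* (EFin \o (fun t => ((x - t) `^ (- beta))%R)))%E).
  apply: integrableMr => //.
  - by apply: subspace_continuous_measurable_fun.
  - have /compact_bounded[M [Mr hM]] := continuous_compact ch (@segment_compact _ a x).
    by exists M; split => // u Mu t tax; apply: hM Mu _ _; exists t.
  - exact: integrable_kernel.
by apply/funext => t; rewrite /= -EFinM powRN.
Qed.

End Kernel.

(** * Linearity of the real and complex Caputo derivatives *)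

Section Caputo.
Context {R : realType} (a b : R).
Hypothesis ab : a < b.

Lemma caputo_lincomb (beta k l x : R) (f g : R -> R) :
  beta <= 1 -> x \in `[a, b] -> cont_diff_on a b f -> cont_diff_on a b g ->
  caputo a b beta (fun t => k * f t + l * g t) x =
  k * caputo a b beta f x + l * caputo a b beta g x.
Proof.
move=> b1 xab df dg; rewrite /caputo; case: eqVneq => [_|bn1].
  exact: deriv_on_lincomb.
have {}b1 : beta < 1 by rewrite lt_neqAle bn1.
have sub : [set` `[a, x]] `<=` [set` `[a, b]].
  by apply: subset_itvl; rewrite bnd_simp; move: xab; rewrite in_itv => /andP[].
have int h : cont_diff_on a b h -> lebesgue_measure.-integrable `[a, x]
    (EFin \o (fun t => deriv_on a b h t / (x - t) `^ beta)).
  move=> [_ ch]; apply: integrable_continuous_kernel => //.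
  exact: continuous_subspaceW ch.
(* The derivative splits only at points of [[a, b]], so membership of t in the integration domain
   has to be used under the integral. *)
under eq_Rintegral => t.
  rewrite inE => /sub tab; rewrite deriv_on_lincomb// mulrDl -!mulrA; over.
rewrite RintegralD//=.
- rewrite !RintegralZl ?mulrDr//; [|exact: int|exact: int].
  by rewrite !(mulrCA _^-1).
- by apply: (integrableZl _ k (int _ df)); exact: measurable_itv.
- by apply: (integrableZl _ l (int _ dg)); exact: measurable_itv.
Qed.

Lemma caputo0 (beta x : R) : x \in `[a, b] -> caputo a b beta (fun=> 0) x = 0.
Proof.
move=> xab; rewrite /caputo; case: eqVneq => _; first exact: deriv_on0.
have sub : [set` `[a, x]] `<=` [set` `[a, b]].
  by apply: subset_itvl; rewrite bnd_simp; move: xab; rewrite in_itv => /andP[].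
under eq_Rintegral => t.
  rewrite inE => /sub tab; rewrite deriv_on0// mul0r; over.
by rewrite Rintegral_cst ?mul0r ?mulr0.
Qed.

End Caputo.

Section ComplexCaputo.
Context {R : realType} (a b : R).
Hypothesis ab : a < b.
Implicit Types (f g : R -> R[i]).

Lemma caputoC_lincomb (beta x : R) (c d : R[i]) f g :
  beta <= 1 -> x \in `[a, b] ->
  cont_diff_on a b (fun t => complex.Re (f t)) ->
  cont_diff_on a b (fun t => complex.Im (f t)) ->
  cont_diff_on a b (fun t => complex.Re (g t)) ->
  cont_diff_on a b (fun t => complex.Im (g t)) ->
  caputoC a b beta (fun t => c * f t + d * g t) x =
  c * caputoC a b beta f x + d * caputoC a b beta g x.
Proof.
move=> b1 xab rf jf rg jg; rewrite /caputoC.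
have lin := @caputo_lincomb R a b ab beta _ _ x _ _ b1 xab.
have cl := @cont_diff_on_lincomb R a b ab.
case: c d => c1 c2 [d1 d2].
(* Complex coefficients mix real and imaginary parts, giving real combinations of four functions.
   They are nested as two-term combinations with outer coefficients 1, so that the real linearity
   lemma applies at both levels. *)
have -> : (fun t => complex.Re ((c1 +i* c2)%C * f t + (d1 +i* d2)%C * g t)) =
  (fun t => 1 * (c1 * complex.Re (f t) + (- c2) * complex.Im (f t)) +
            1 * (d1 * complex.Re (g t) + (- d2) * complex.Im (g t))).
  by apply/funext => t; case: (f t) (g t) => [? ?] [? ?] /=; ring.
have -> : (fun t => complex.Im ((c1 +i* c2)%C * f t + (d1 +i* d2)%C * g t)) =
  (fun t => 1 * (c1 * complex.Im (f t) + c2 * complex.Re (f t)) +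
            1 * (d1 * complex.Im (g t) + d2 * complex.Re (g t))).
  by apply/funext => t; case: (f t) (g t) => [? ?] [? ?] /=; ring.
rewrite !lin//; try exact: cl.
do 4![move: (caputo _ _ _ _ _) => ?].
by apply/eqP; rewrite eq_complex /=; apply/andP; split; apply/eqP; ring.
Qed.

Lemma caputoC0 (beta x : R) : x \in `[a, b] -> caputoC a b beta (fun=> 0) x = 0.
Proof. by move=> xab; rewrite /caputoC /= !caputo0. Qed.

End ComplexCaputo.

(** * Quaternion products and the splitting into scalar and vector parts *)

Section Quaternions.
Variable C : comNzRingType.

Lemma quat_sqr (n : 'I_3) :
  quat_mul (quat_vec C n) (quat_vec C n) = - quat_e C ord0.
Proof.
apply/rowP => i; rewrite -(inord_val i).
case: i => [[|[|[|[|//]]]] ilt]; case: n => [[|[|[|//]]] ?];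
  rewrite !mxE !inordK //= !eqE /= !inordK //= /bump /=; ring.
Qed.

Lemma quat_vec_swap (m n : 'I_3) : m != n ->
  quat_mul (quat_vec C m) (quat_vec C n) = - quat_mul (quat_vec C n) (quat_vec C m).
Proof.
move=> /negbTE mn; apply/eqP; rewrite -addr_eq0 quat_anticomm mn.
by rewrite oppr0 mul0rn scale0r.
Qed.

(** The diagonal terms are scalars because each unit squares to -1. Off the diagonal,
    anticommutation pairs the terms (n, m) and (m, n) into one difference along the third unit, as
    in a curl. *)
Lemma quat_mul_sum (D : 'I_3 -> 'I_3 -> C) :
  \sum_n \sum_m D n m *: quat_mul (quat_vec C n) (quat_vec C m) =
  quat_of (- \sum_n D n n)
    (\row_k [:: D 'x2 'x3 - D 'x3 'x2; D 'x3 'x1 - D 'x1 'x3;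
                D 'x1 'x2 - D 'x2 'x1]`_k).
Proof.
have o0 : (ord0 : 'I_3) = 'x1 by exact: val_inj.
have o1 : lift ord0 (ord0 : 'I_2) = 'x2 by exact: val_inj.
have o2 : lift ord0 (lift ord0 (ord0 : 'I_1)) = 'x3 by exact: val_inj.
rewrite !big_ord_recl !big_ord0 o2 o1 o0 !quat_sqr.
(* Products against the cyclic order are reversed, leaving only e1 e2, e2 e3 and e3 e1. *)
rewrite (@quat_vec_swap 'x2 'x1)// (@quat_vec_swap 'x3 'x2)//.
rewrite (@quat_vec_swap 'x1 'x3)// quat_e12 quat_e23 quat_e31.
apply/rowP => i; rewrite !mxE /=.
case: (unliftP ord0 i) => [k|] ->; last first.
  by rewrite /= !mulr0 !oppr0; ring.
case: k => [[|[|[|//]]] ?]; rewrite mxE -!val_eqE /= /bump /=; ring.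
Qed.

Lemma quat_ofD (s t : C) (u v : 'rV[C]_3) :
  quat_of s u + quat_of t v = quat_of (s + t) (u + v).
Proof. by apply/rowP => i; rewrite !mxE; case: unlift => [k|//]; rewrite mxE. Qed.

Lemma quat_ofZ (k s : C) (v : 'rV[C]_3) :
  k *: quat_of s v = quat_of (k * s) (k *: v).
Proof. by apply/rowP => i; rewrite !mxE; case: unlift => [n|//]; rewrite mxE. Qed.

Lemma quat_of_inj (s t : C) (u v : 'rV[C]_3) :
  quat_of s u = quat_of t v -> s = t /\ u = v.
Proof.
move=> /rowP uv; split; first by have := uv ord0; rewrite !mxE unlift_none.
by apply/rowP => i; have := uv (lift ord0 i); rewrite !mxE liftK.
Qed.

End Quaternions.

(** * Pointwise linear algebra of the scalar and vector equations *)

Section LinearAlgebra.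
Variable F : numFieldType.

(** Here e and b stand for Div E and Div B, q for Div j and r for g1 rho. The difference of the two
    equations is 2 c e = 2 g q, and their sum is - 2 kappa b = 0. *)
Lemma div_equations_equiv (c kappa g e b q r : F) :
  c != 0 -> kappa != 0 -> g * q = c * r ->
  (- (- c * e + kappa * b) = g * q /\ - (c * e + kappa * b) = g * - q) <->
  (e = r /\ b = 0).
Proof.
move=> c0 k0 gq; split=> [[h1 h2]|[-> ->]]; last by split; rewrite ?mulrN gq; ring.
split.
- apply: (mulfI c0); rewrite -gq; apply: (@mulfI _ 2); first by rewrite pnatr_eq0.
  have -> : 2 * (g * q) = g * q - g * - q by ring.
  by rewrite -h1 -h2; ring.
- apply: (mulfI k0); apply: (@mulfI _ 2); first by rewrite pnatr_eq0.
  rewrite mulr0 mulr0; have -> : 0 = - (g * q + g * - q) by ring.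
  by rewrite -h1 -h2; ring.
Qed.

(** The difference of the two equations gives c CE = - kappa^2 B, where - kappa^2 = c w; their sum
    is kappa times the equation for CB, up to the factor 2. *)
Lemma curl_equations_equiv (n : nat) (c kappa w g : F) (E B J CE CB : 'rV[F]_n) :
  c != 0 -> kappa != 0 -> c * w = - kappa ^+ 2 ->
  (- c *: CE + kappa *: CB - kappa *: (- c *: E + kappa *: B) =
     g *: (kappa *: J) /\
   c *: CE + kappa *: CB + kappa *: (c *: E + kappa *: B) = g *: (kappa *: J)) <->
  (CE = w *: B /\ CB = - c *: E + g *: J).
Proof.
move=> c0 k0 cw; have two0 : (2 : F) != 0 by rewrite pnatr_eq0.
split=> [[/rowP h1 /rowP h2]|[-> ->]].
- split; apply/rowP => i; have := h1 i; have := h2 i; rewrite !mxE => {}h2 {}h1.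
  + apply: (mulfI c0); rewrite mulrA cw; apply: (mulfI two0); apply/eqP.
    (* With everything moved to the left, the scaled goal and the difference of the equations are
       the same polynomial. *)
    have /eqP := etrans h2 (esym h1); rewrite -subr_eq0 -[_ == _ in X in _ -> X]subr_eq0.
    by congr (_ == 0) => /=; ring.
  + apply: (mulfI k0); apply: (mulfI two0); apply/eqP.
    have /eqP := congr2 +%R h1 h2; rewrite -subr_eq0 -[_ == _ in X in _ -> X]subr_eq0.
    by congr (_ == 0) => /=; ring.
- split; apply/rowP => i; rewrite !mxE.
  + ring: cw.
  + ring: cw.
Qed.

End LinearAlgebra.

(** * The fractional operators on vector fields of the cube *)

Section Operators.
Context {R : realType} (a b : R) (alpha : 'I_3 -> R).
Hypothesis ab : a < b.
Hypothesis alpha1 : forall n, alpha n <= 1.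
Implicit Types (U V : 'rV[R]_3 -> 'rV[R[i]]_3) (x : 'rV[R]_3).

Lemma pcaputo_lincomb (n m : 'I_3) (c d : R[i]) U V x :
  AC1_field a b U -> AC1_field a b V -> cube a b x ->
  pcaputo a b alpha n (fun y => (c *: U y + d *: V y) 0 m) x =
  c * pcaputo a b alpha n (fun y => U y 0 m) x +
  d * pcaputo a b alpha n (fun y => V y 0 m) x.
Proof.
move=> hU hV xW; rewrite /pcaputo; under eq_fun do rewrite !mxE.
have [rU jU] := hU m; have [rV jV] := hV m.
apply: caputoC_lincomb => //.
- by rewrite ler_pdivrMr// mul1r lerD2l.
- exact: (rU x xW n).1.
- exact: (jU x xW n).1.
- exact: (rV x xW n).1.
- exact: (jV x xW n).1.
Qed.

Lemma fdiv_lincomb (c d : R[i]) U V x :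
  AC1_field a b U -> AC1_field a b V -> cube a b x ->
  fdiv a b alpha (fun y => c *: U y + d *: V y) x =
  c * fdiv a b alpha U x + d * fdiv a b alpha V x.
Proof.
move=> hU hV xW; rewrite /fdiv !mulr_sumr -big_split /=.
by apply: eq_bigr => n _; exact: pcaputo_lincomb.
Qed.

Lemma fcurl_lincomb (c d : R[i]) U V x :
  AC1_field a b U -> AC1_field a b V -> cube a b x ->
  fcurl a b alpha (fun y => c *: U y + d *: V y) x =
  c *: fcurl a b alpha U x + d *: fcurl a b alpha V x.
Proof.
move=> hU hV xW; rewrite /fcurl /= !pcaputo_lincomb//.
do 12![move: (pcaputo _ _ _ _ _ _) => ?].
by apply/rowP => -[[|[|[|//]]] ?]; rewrite !mxE /=; ring.
Qed.

(** The zero scalar coefficient has zero Caputo derivative; the remaining double sum over vector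
    units is evaluated by [quat_mul_sum]. *)
Lemma fdirac_vector V x : cube a b x ->
  fdirac a b alpha (fun y => quat_of 0 (V y)) x =
  quat_of (- fdiv a b alpha V x) (fcurl a b alpha V x).
Proof.
move=> xW; rewrite /fdirac /fdiv /fcurl.
have D0 n : pcaputo a b alpha n (fun y => quat_of 0 (V y) 0 ord0) x = 0.
  by rewrite /pcaputo; under eq_fun do rewrite mxE unlift_none; exact: caputoC0.
have DV n m : pcaputo a b alpha n (fun y => quat_of 0 (V y) 0 (lift ord0 m)) x =
    pcaputo a b alpha n (fun y => V y 0 m) x.
  apply: (congr1 (fun f => pcaputo a b alpha n f x)).
  by apply/funext => y; rewrite mxE liftK.
under eq_bigr => n _.
  rewrite big_ord_recl D0 scale0r add0r.
  under eq_bigr do rewrite DV.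
  over.
by rewrite (quat_mul_sum R[i] (fun n m => pcaputo a b alpha n (fun y => V y 0 m) x)).
Qed.

End Operators.

(** * Equivalence of the quaternionic and Maxwell systems *)

Theorem theorem2 (R : realType) (a b : R) (hab : a < b)
  (alpha : 'I_3 -> R) (halpha : forall n : 'I_3, 0 < alpha n /\ alpha n <= 1)
  (omega : R[i]) (homega : omega != 0)
  (g1 g2 g3 : R[i]) (hg2 : g2 != 0) (hg3 : g3 != 0)
  (s : R[i]) (hs : s ^+ 2 = g2^-1 * g3^-1)
  (kappa : R[i]) (hkappa : kappa = omega * s) (hkappa_im : 0 <= complex.Im kappa)
  (rho : 'rV[R]_3 -> R[i]) (j E B : 'rV[R]_3 -> 'rV[R[i]]_3)
  (hj : AC1_field a b j) (hE : AC1_field a b E) (hB : AC1_field a b B)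
  (hcharge : charge_conservation a b alpha omega g1 g3 rho j)
  (phi psi : 'rV[R]_3 -> 'rV[R[i]]_4)
  (hphi : forall x : 'rV[R]_3, phi x =
    quat_of 0 (- ('i%C * omega * g2^-1 * g3^-1) *: E x + kappa *: B x))
  (hpsi : forall x : 'rV[R]_3, psi x =
    quat_of 0 (('i%C * omega * g2^-1 * g3^-1) *: E x + kappa *: B x)) :
  (forall x : 'rV[R]_3, cube a b x ->
     fdirac a b alpha phi x - kappa *: phi x =
       g2^-1 *: quat_of (fdiv a b alpha j x) (kappa *: j x)
     /\
     fdirac a b alpha psi x + kappa *: psi x =
       g2^-1 *: quat_of (- fdiv a b alpha j x) (kappa *: j x))
  <->
  (forall x : 'rV[R]_3, cube a b x ->
     [/\ fdiv a b alpha E x = g1 * rho x,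
         fcurl a b alpha E x = ('i%C * omega) *: B x,
         fdiv a b alpha B x = 0 &
         fcurl a b alpha B x =
           - ('i%C * omega * g2^-1 * g3^-1) *: E x + g2^-1 *: j x]).
Proof.
set c := 'i%C * omega * g2^-1 * g3^-1 in hphi hpsi *.
have alpha1 n : alpha n <= 1 by have [] := halpha n.
have s0 : s != 0.
  by rewrite -sqrf_eq0 hs mulf_neq0 ?invr_neq0.
have k0 : kappa != 0 by rewrite hkappa mulf_neq0.
have i0 : 'i%C != 0 :> R[i] by rewrite eq_complex /= oner_eq0 andbF.
have c0 : c != 0 by rewrite !mulf_neq0 ?invr_neq0.
have cw : c * ('i%C * omega) = - kappa ^+ 2.
  rewrite hkappa exprMn hs /c mulrACA.
  have i2 : 'i%C * 'i%C = -1 :> R[i] by rewrite -expr2 sqr_i.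
  ring: i2.
(* The equivalence already holds at each point: once the operators are expanded, their values at x
   enter only as unknowns of a linear system. *)
suff equiv x : cube a b x ->
    (fdirac a b alpha phi x - kappa *: phi x =
       g2^-1 *: quat_of (fdiv a b alpha j x) (kappa *: j x)
     /\
     fdirac a b alpha psi x + kappa *: psi x =
       g2^-1 *: quat_of (- fdiv a b alpha j x) (kappa *: j x)) <->
    [/\ fdiv a b alpha E x = g1 * rho x,
        fcurl a b alpha E x = ('i%C * omega) *: B x,
        fdiv a b alpha B x = 0 &
        fcurl a b alpha B x = - c *: E x + g2^-1 *: j x].
  by split=> H x xW; apply/(equiv x xW); exact: H.
move=> xW.
(* Charge conservation enters here: i omega g1 / g3 times 1 / g2 is exactly c g1. *)
have gj : g2^-1 * fdiv a b alpha j x = c * (g1 * rho x).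
  by rewrite hcharge// /c; ring.
clearbody c.
have divE := div_equations_equiv _ c kappa _ (fdiv a b alpha E x) (fdiv a b alpha B x)
  _ _ c0 k0 gj.
have curlE := curl_equations_equiv _ 3 c kappa _ g2^-1 (E x) (B x) (j x)
  (fcurl a b alpha E x) (fcurl a b alpha B x) c0 k0 cw.
(* An equality of functions is needed, since the Dirac operator differentiates [phi] and [psi]. *)
have -> : phi = fun y => quat_of 0 (- c *: E y + kappa *: B y) by exact/funext.
have -> : psi = fun y => quat_of 0 (c *: E y + kappa *: B y) by exact/funext.
rewrite !fdirac_vector// !fdiv_lincomb// !fcurl_lincomb//.
(* Each side becomes a single [quat_of]. The term kappa times the field has zero scalar part, so the
   scalar equations contain only divergences. *)
rewrite -[- (kappa *: _)]scaleNr !quat_ofZ !quat_ofD !mulr0 !addr0 [- kappa *: _]scaleNr.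
split.
- move=> [/quat_of_inj[d1 v1] /quat_of_inj[d2 v2]].
  by have [-> ->] := divE.1 (conj d1 d2); have [-> ->] := curlE.1 (conj v1 v2).
- move=> [e1 e2 e3 e4].
  have [-> ->] := divE.2 (conj e1 e3).
  by have [-> ->] := curlE.2 (conj e2 e4).
Qed.
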